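(* Consider the three-dimensional compressible Euler equations with density $\rho$, velocity $(v_1,v_2,v_3)=(u,v,w)$, pressure $p$, specific inner energy $\theta$, specific total energy $e$ and specific enthalpy $h=e+p/\rho$, and the nodal discontinuous Galerkin spectral element method (DGSEM) in volume flux differencing form described in the context, in which the volume term in direction $d\in\{1,2,3\}$ (that is, $x,y,z$) is, along each line of nodes in that direction with nodal states $U_0,\dots,U_N$, $2\sum_{m=0}^N D_{im}F_d^{\#}(U_i,U_m)$, $i=0,\dots,N$, with a two-point numerical volume flux $F_d^{\#}$. A high-order accurate and consistent DGSEM discretisation of the alternative Euler formulations of Morinishi (MO), Ducros et al. (DU), Kennedy and Gruber (KG), and Pirozzoli (PI), as given in the context, can be generated by translating the quadratic and cubic split forms into the corresponding numerical volume flux. The volume fluxes for the standard DGSEM in divergence form and for each alternative formulation are the following, where $\{\{a\}\}$ denotes the arithmetic mean $\frac12(a_i+a_m)$ of the quantity $a$ over the two argument states $U_i,U_m$, and $F_d^{\#,1}$, $F_d^{\#,1+q}$ ($q=1,2,3$), $F_d^{\#,5}$ are the mass, momentum and energy components: Standard DG: $F_d^{\#,1}=\{\{\rho v_d\}\}$, $F_d^{\#,1+q}=\{\{\rho v_d v_q\}\}+\delta_{qd}\{\{p\}\}$, $F_d^{\#,5}=\{\{v_d(\rho e+p)\}\}$. Morinishi: $F_d^{\#,1}=\{\{\rho v_d\}\}$, $F_d^{\#,1+q}=\{\{\rho v_d\}\}\{\{v_q\}\}+\delta_{qd}\{\{p\}\}$, $F_d^{\#,5}=\{\{(\rho\theta+p)v_d\}\}+\sum_{q=1}^3\{\{\rho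 v_d v_q\}\}\{\{v_q\}\}-\frac12\sum_{q=1}^3\{\{\rho v_d v_q^2\}\}$. Ducros et al.: $F_d^{\#,1}=\{\{\rho\}\}\{\{v_d\}\}$, $F_d^{\#,1+q}=\{\{\rho v_q\}\}\{\{v_d\}\}+\delta_{qd}\{\{p\}\}$, $F_d^{\#,5}=(\{\{\rho e\}\}+\{\{p\}\})\{\{v_d\}\}$. Kennedy and Gruber: $F_d^{\#,1}=\{\{\rho\}\}\{\{v_d\}\}$, $F_d^{\#,1+q}=\{\{\rho\}\}\{\{v_d\}\}\{\{v_q\}\}+\delta_{qd}\{\{p\}\}$, $F_d^{\#,5}=\{\{\rho\}\}\{\{v_d\}\}\{\{e\}\}+\{\{p\}\}\{\{v_d\}\}$. Pirozzoli: $F_d^{\#,1}=\{\{\rho\}\}\{\{v_d\}\}$, $F_d^{\#,1+q}=\{\{\rho\}\}\{\{v_d\}\}\{\{v_q\}\}+\delta_{qd}\{\{p\}\}$, $F_d^{\#,5}=\{\{\rho\}\}\{\{v_d\}\}\{\{h\}\}$.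
   Context: Compressible Euler equations: $U_t+\mathcal{L}_1(U)+\mathcal{L}_2(U)+\mathcal{L}_3(U)=0$ with $U=(\rho,\rho v_1,\rho v_2,\rho v_3,\rho e)$, $\rho e=\rho\theta+\frac12\rho(v_1^2+v_2^2+v_3^2)$ and $p=(\gamma-1)\rho\theta$, $\gamma$ being the adiabatic coefficient. Here $\mathcal{L}_d$ is the nonlinear spatial differential operator in direction $x_d$, $(x_1,x_2,x_3)=(x,y,z)$. Below, subscript $x$ stands for $\partial/\partial x_d$, and $\delta_{qd}$ is the Kronecker symbol. Quadratic and cubic split forms of derivatives of products: $S_2[a,b]:=\frac12\left((ab)_x+a\,b_x+b\,a_x\right)$ and $S_3[a,b,c]:=\frac14\left((abc)_x+a(bc)_x+b(ac)_x+c(ab)_x+bc\,a_x+ac\,b_x+ab\,c_x\right)$. Forms of $\mathcal{L}_d$ (components: mass; momentum $q=1,2,3$; energy): Standard divergence form: $(\rho v_d)_x$; $(\rho v_dv_q)_x+\delta_{qd}p_x$; $((\rho e+p)v_d)_x$. Morinishi: $(\rho v_d)_x$; $S_2[\rho v_d,v_q]+\delta_{qd}p_x$; $((\rho\theta+p)v_d)_x+\frac12\sum_{q=1}^3\left(\rho v_dv_q\,(v_q)_x+v_q\,(\rho v_dv_q)_x\right)$. Ducros et al.: $S_2[\rho,v_d]$; $S_2[\rho v_q,v_d]+\delta_{qd}p_x$; $S_2[\rho e+p,v_d]$. Kennedy and Gruber: $S_2[\rho,v_d]$; $S_3[\rho,v_d,v_q]+\delta_{qd}p_x$; $S_2[p,v_d]+S_3[\rho,e,v_d]$.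 Pirozzoli: $S_2[\rho,v_d]$; $S_3[\rho,v_d,v_q]+\delta_{qd}p_x$; $S_3[\rho,v_d,h]$. DGSEM: the domain is divided into Cartesian hexahedral elements, each mapped to $[-1,1]^3$; in each element the conservative variables are approximated by tensor-product polynomials of degree $N$ in each reference coordinate, represented by nodal values at the $(N+1)^3$ Gauss-Lobatto (GL) nodes, which are also used for quadrature. $D_{im}=\ell_m'(\xi_i)$ is the polynomial derivative matrix, with $\ell_0,\dots,\ell_N$ the Lagrange basis polynomials of the GL nodes $\xi_0,\dots,\xi_N\in[-1,1]$. The standard strong form DGSEM approximates the reference-space derivative of the physical flux in each direction by a volume term $\sum_{m}D_{im}F_m$ (with $F_m$ the physical flux at node $m$ of the line) plus interface terms formed from the differences between a numerical surface flux and the physical flux at the two element faces in that direction. The volume flux differencing form keeps the interface terms and replaces the volume term by $2\sum_{m}D_{im}F_d^{\#}(U_i,U_m)$. *)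

(* Defs.v *)
From HB Require Import structures.
From mathcomp Require Import all_boot all_order all_algebra.
From mathcomp Require Import all_classical all_reals all_analysis.

Set Implicit Arguments.
Unset Strict Implicit.
Unset Printing Implicit Defensive.

Import Order.TTheory GRing.Theory Num.Theory.
Import numFieldNormedType.Exports.

Local Open Scope classical_set_scope.
Local Open Scope ring_scope.

(* Directions x, y, z and velocity indices are the elements 0, 1, 2 of 'I_3. *)
Inductive component := Mass | Momentum of 'I_3 | Energy.

(* Conservative variables (rho, rho v_1, rho v_2, rho v_3, rho e). *)
Definition state (R : realType) := component -> R.

Section Euler.
Context {R : realType} (gamma : R).
Implicit Types (V : state R) (d q : 'I_3).

Definition density V : R := V Mass.
Definition velocity q V : R := V (Momentum q) / density V.
Definition total_energy V : R := V Energy / density V.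
Definition inner_energy V : R :=
  total_energy V - 2^-1 * \sum_q velocity q V ^+ 2.
Definition pressure V : R := (gamma - 1) * density V * inner_energy V.
Definition enthalpy V : R := total_energy V + pressure V / density V.

Definition euler_flux d V : state R := fun c =>
  let r := density V in let v q := velocity q V in
  let p := pressure V in let e := total_energy V in
  match c with
  | Mass => r * v d
  | Momentum q => r * v d * v q + (q == d)%:R * p
  | Energy => (r * e + p) * v d
  end.

Inductive formulation :=
  StandardDivergence | Morinishi | Ducros | KennedyGruber | Pirozzoli.

(* The forms of the operator L_d are parametrized by the first-order operator
   [Dx] acting on scalar functions on a set of points [T]: for a partial
   derivative on R^3 this is the PDE operator, for the derivative matrix acting
   on the nodal values of a line it is the discrete split form. *)
Section SplitForms.
Context {T : Type} (Dx : (T -> R) -> T -> R).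

Definition S2 (a b : T -> R) : T -> R := fun x =>
  2^-1 * (Dx (a \* b) x + a x * Dx b x + b x * Dx a x).

Definition S3 (a b c : T -> R) : T -> R := fun x =>
  4^-1 * (Dx (a \* b \* c) x
          + a x * Dx (b \* c) x + b x * Dx (a \* c) x + c x * Dx (a \* b) x
          + b x * c x * Dx a x + a x * c x * Dx b x + a x * b x * Dx c x).

Definition euler_form (X : formulation) d (U : T -> state R) :
    component -> T -> R := fun c x =>
  let r := density \o U in let v q := velocity q \o U in
  let p := pressure \o U in let e := total_energy \o U in
  let th := inner_energy \o U in let h := enthalpy \o U in
  match X, c with
  | StandardDivergence, Mass => Dx (r \* v d) x
  | StandardDivergence, Momentum q =>
      Dx (r \* v d \* v q) x + (q == d)%:R * Dx p x
  | StandardDivergence, Energy => Dx ((r \* e \+ p) \* v d) x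
  | Morinishi, Mass => Dx (r \* v d) x
  | Morinishi, Momentum q =>
      S2 (r \* v d) (v q) x + (q == d)%:R * Dx p x
  | Morinishi, Energy =>
      Dx ((r \* th \+ p) \* v d) x
      + 2^-1 * \sum_q ((r \* v d \* v q) x * Dx (v q) x
                       + v q x * Dx (r \* v d \* v q) x)
  | Ducros, Mass => S2 r (v d) x
  | Ducros, Momentum q => S2 (r \* v q) (v d) x + (q == d)%:R * Dx p x
  | Ducros, Energy => S2 (r \* e \+ p) (v d) x
  | KennedyGruber, Mass => S2 r (v d) x
  | KennedyGruber, Momentum q =>
      S3 r (v d) (v q) x + (q == d)%:R * Dx p x
  | KennedyGruber, Energy => S2 p (v d) x + S3 r e (v d) x
  | Pirozzoli, Mass => S2 r (v d) x
  | Pirozzoli, Momentum q =>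
      S3 r (v d) (v q) x + (q == d)%:R * Dx p x
  | Pirozzoli, Energy => S3 r (v d) h x
  end.

End SplitForms.

Definition mean (x y : R) : R := 2^-1 * (x + y).

Definition volume_flux (X : formulation) d (V W : state R) : state R := fun c =>
  let m (a : state R -> R) := mean (a V) (a W) in
  let r := density in let v := velocity in let p := pressure in
  let e := total_energy in let th := inner_energy in let h := enthalpy in
  match X, c with
  | StandardDivergence, Mass => m (r \* v d)
  | StandardDivergence, Momentum q => m (r \* v d \* v q) + (q == d)%:R * m p
  | StandardDivergence, Energy => m (v d \* (r \* e \+ p))
  | Morinishi, Mass => m (r \* v d)
  | Morinishi, Momentum q => m (r \* v d) * m (v q) + (q == d)%:R * m p
  | Morinishi, Energy =>
      m ((r \* th \+ p) \* v d)
      + \sum_q m (r \* v d \* v q) * m (v q)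
      - 2^-1 * \sum_q m (r \* v d \* (v q \* v q))
  | Ducros, Mass => m r * m (v d)
  | Ducros, Momentum q => m (r \* v q) * m (v d) + (q == d)%:R * m p
  | Ducros, Energy => (m (r \* e) + m p) * m (v d)
  | KennedyGruber, Mass => m r * m (v d)
  | KennedyGruber, Momentum q =>
      m r * m (v d) * m (v q) + (q == d)%:R * m p
  | KennedyGruber, Energy => m r * m (v d) * m e + m p * m (v d)
  | Pirozzoli, Mass => m r * m (v d)
  | Pirozzoli, Momentum q =>
      m r * m (v d) * m (v q) + (q == d)%:R * m p
  | Pirozzoli, Energy => m r * m (v d) * m h
  end.

Definition numerical_flux := 'I_3 -> state R -> state R -> state R.

Definition consistent_on (A : set (state R)) (F : numerical_flux) : Prop :=
  forall d V c, A V -> F d V V c = euler_flux d V c.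

End Euler.

Section GaussLobatto.
Context {R : realType}.

Definition legendre (N : nat) : {poly R} :=
  (2 ^+ N * N`!%:R)^-1 *: derivn N (('X^2 - 1) ^+ N).

(* For [0 < N] the polynomial (X^2 - 1) P_N' has degree N + 1, so N + 1 strictly
   increasing roots are all of its roots: -1, 1 and the zeros of P_N'. *)
Definition GL_nodes (N : nat) (xi : 'I_N.+1 -> R) : Prop :=
  (forall i j : 'I_N.+1, (i < j)%N -> xi i < xi j) /\
  (forall i, root (('X^2 - 1) * deriv (legendre N)) (xi i)).

Context {N : nat} (xi : 'I_N.+1 -> R).

Definition lagrange_basis (m : 'I_N.+1) : {poly R} :=
  \prod_(k < N.+1 | k != m) ((xi m - xi k)^-1 *: ('X - (xi k)%:P)).

Definition derivative_matrix : 'M[R]_N.+1 :=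
  \matrix_(i, m) (deriv (lagrange_basis m)).[xi i].

Definition GL_weight (i : 'I_N.+1) : R :=
  \int[lebesgue_measure]_(x in `[-1, 1]) (lagrange_basis i).[x].

Definition nodal_derivative (a : 'I_N.+1 -> R) (i : 'I_N.+1) : R :=
  \sum_m derivative_matrix i m * a m.

End GaussLobatto.

Section DGSEM.
Context {R : realType} (gamma : R) {N : nat} (xi : 'I_N.+1 -> R).

Definition line_operator := ('I_N.+1 -> state R) -> 'I_N.+1 -> state R.

Definition standard_volume_term (d : 'I_3) : line_operator := fun L i c =>
  \sum_m derivative_matrix xi i m * euler_flux gamma d (L m) c.

Definition flux_differencing_volume_term (F : numerical_flux (R := R))
    (d : 'I_3) : line_operator := fun L i c =>
  2 * \sum_m derivative_matrix xi i m * F d (L i) (L m) c.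

Definition node_index := 'I_3 -> 'I_N.+1.

Definition set_index (J : node_index) (d : 'I_3) (m : 'I_N.+1) : node_index :=
  fun q => if q == d then m else J q.

(* [W] are the nodal states of the element; [outer d s J] is the state on the
   other side of the face x_d = max (s = true) or x_d = min (s = false) at the
   face node [J]. The two arguments of the surface flux are ordered along +x_d. *)
Definition interface_term (Fs : numerical_flux) (d : 'I_3)
    (outer : bool -> node_index -> state R) (W : node_index -> state R)
    (J : node_index) : state R := fun c =>
  (J d == ord_max)%:R / GL_weight xi ord_max
    * (Fs d (W J) (outer true J) c - euler_flux gamma d (W J) c)
  - (J d == ord0)%:R / GL_weight xi ord0
    * (Fs d (outer false J) (W J) c - euler_flux gamma d (W J) c).

(* The factor 2 / Delta_d is the metric term of the affine map from [-1, 1]^3 to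
   a box with side lengths Delta. *)
Definition dgsem_direction (vol : 'I_3 -> line_operator) (Fs : numerical_flux)
    (Delta : 'rV[R]_3) (outer : 'I_3 -> bool -> node_index -> state R)
    (W : node_index -> state R) (d : 'I_3) (J : node_index) : state R := fun c =>
  2 / Delta 0 d
    * (vol d (fun m => W (set_index J d m)) (J d) c
       + interface_term Fs d (outer d) W J c).

(* The semi-discrete scheme is dW/dt + dgsem_operator W = 0. *)
Definition dgsem_operator (vol : 'I_3 -> line_operator) (Fs : numerical_flux)
    (Delta : 'rV[R]_3) (outer : 'I_3 -> bool -> node_index -> state R)
    (W : node_index -> state R) (J : node_index) : state R := fun c =>
  \sum_d dgsem_direction vol Fs Delta outer W d J c.

Definition element (x0 Delta : 'rV[R]_3) : set 'rV[R]_3 :=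
  [set x | forall d, x0 0 d <= x 0 d <= x0 0 d + Delta 0 d].

Definition node (x0 Delta : 'rV[R]_3) (J : node_index) : 'rV[R]_3 :=
  \row_d (x0 0 d + Delta 0 d / 2 * (xi (J d) + 1)).

End DGSEM.

Section Smoothness.
Context {R : realType}.

Definition partial (d : 'I_3) (f : 'rV[R]_3 -> R) : 'rV[R]_3 -> R :=
  fun x => 'D_(delta_mx 0 d) f x.

Fixpoint Ck (k : nat) (Omega : set 'rV[R]_3) (f : 'rV[R]_3 -> R) : Prop :=
  (forall x, Omega x -> {for x, continuous f}) /\
  match k with
  | 0%N => True
  | k'.+1 => forall d,
      (forall x, Omega x -> derivable f x (delta_mx 0 d)) /\
      Ck k' Omega (partial d f)
  end.

End Smoothness.

(* Main.v *)
Require Import Defs.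
From HB Require Import structures.
From mathcomp Require Import all_boot all_order all_algebra.
From mathcomp Require Import all_classical all_reals all_analysis.
From mathcomp Require Import ring lra.

Set Implicit Arguments.
Unset Strict Implicit.
Unset Printing Implicit Defensive.

Import Order.TTheory GRing.Theory Num.Theory.
Import numFieldNormedType.Exports.

Local Open Scope classical_set_scope.
Local Open Scope ring_scope.

(** The matrix [derivative_matrix xi] differentiates polynomials of degree at
    most N exactly at the nodes, because Lagrange interpolation reproduces them
    ([nodal_derivative_exact]); in particular its rows sum to zero. Expanding a
    product of two or three arithmetic means in the two-point flux, every
    contribution that depends on the node i alone is multiplied by such a row
    sum and drops out, and what remains is the split form with the matrix in the
    place of the derivative ([flux_diff_mean], [flux_diff_mean2],
    [flux_diff_mean3]). The fluxes are linear combinations of such products, so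
    the discrete split forms follow term by term
    ([flux_differencing_euler_form]). In the energy flux of Morinishi, the
    subtracted mean of the triple products cancels the conservative part of
    the quadratic splitting, and leaves the advective terms.

    For the accuracy, all states on a line come from one smooth field, so the
    two arguments of a consistent surface flux coincide at the faces and the
    interface terms vanish ([interface_term_eq0]). Each form is a sum of terms
    g(U) D(f(U)), with f and g rational in the conservative variables and the
    density as only denominator; the discrete and the continuous form differ by
    the choice of D alone. It is enough to bound the error of the scaled
    collocation derivative of a scalar function of class N + 1 on an element
    ([nodal_derivative_error]): its Taylor polynomial of degree N at the node is
    differentiated exactly, and the remainder is of order N + 1 in the side
    length while the metric term costs one power. The (N+1)-st partial
    derivative and the coefficients g(U) are bounded because they are continuous
    on a compact set, which makes the constants independent of the element.

    The nodes lie in the element because every |xi_i| is at most 1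
    ([GL_nodes_bounded]): the interior nodes are the roots of P_N', which is a
    multiple of the derivative of order N + 1 of (x^2 - 1)^N. After the
    substitution x = +-(1 + t) the latter is a polynomial in t with nonnegative
    coefficients, so none of its nonzero derivatives vanishes for t > 0. *)

(** * Collocation derivative at distinct nodes *)

Lemma lagrange_basis_nodes (R : realType) (N : nat) (xi : 'I_N.+1 -> R)
    (xi_inj : injective xi) (m k : 'I_N.+1) :
  (lagrange_basis xi m).[xi k] = (k == m)%:R.
Proof.
rewrite /lagrange_basis horner_prod; have [->|km] := eqVneq k m.
  apply: big1 => j jm; rewrite !hornerE mulVf//.
  by rewrite subr_eq0; apply: contra jm => /eqP/xi_inj->.
by rewrite (bigD1 k)//= !hornerE subrr mulr0 mul0r.
Qed.

Lemma size_lagrange_basis (R : realType) (N : nat) (xi : 'I_N.+1 -> R)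
    (m : 'I_N.+1) : (size (lagrange_basis xi m) <= N.+1)%N.
Proof.
apply: leq_trans (size_poly_prod_leq _ _) _.
have card_m : #|[pred k : 'I_N.+1 | k != m]| = N by rewrite cardC1 card_ord.
rewrite card_m leq_subLR.
apply: (@leq_trans (\sum_(k < N.+1 | k != m) 2).+1).
  by rewrite ltnS; apply: leq_sum => k _;
    rewrite (leq_trans (size_scale_leq _ _))// size_XsubC.
by rewrite sum_nat_const card_m muln2 -addnn addnS.
Qed.

(** The difference has N + 1 distinct roots and size at most N + 1. *)
Lemma lagrange_interpolation (R : realType) (N : nat) (xi : 'I_N.+1 -> R)
    (xi_inj : injective xi) (p : {poly R}) : (size p <= N.+1)%N ->
  p = \sum_m p.[xi m] *: lagrange_basis xi m.
Proof.
move=> sp; apply/eqP; rewrite -subr_eq0; apply/eqP.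
apply: (@roots_geq_poly_eq0 _ _ [seq xi i | i <- enum 'I_N.+1]).
- apply/allP => _ /mapP[k _ ->].
  rewrite /root hornerD hornerN horner_sum (bigD1 k)//=.
  rewrite hornerZ lagrange_basis_nodes// eqxx mulr1 big1 ?addr0 ?subrr//
    => m mk.
  by rewrite hornerZ lagrange_basis_nodes// eq_sym (negPf mk) mulr0.
- by rewrite map_inj_uniq ?enum_uniq.
rewrite size_map size_enum_ord (leq_trans (size_polyD _ _))// geq_max sp
  size_polyN.
apply: (leq_trans (size_sum _ _ _)); apply/bigmax_leqP => m _.
exact: leq_trans (size_scale_leq _ _) (size_lagrange_basis _ _).
Qed.

(** The source of both the split forms (through the constant 1) and the order
    of accuracy (through Taylor polynomials). *)
Lemma nodal_derivative_exact (R : realType) (N : nat) (xi : 'I_N.+1 -> R)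
    (xi_inj : injective xi) (p : {poly R}) (i : 'I_N.+1) : (size p <= N.+1)%N ->
  nodal_derivative xi (fun m => p.[xi m]) i = (deriv p).[xi i].
Proof.
move=> sp; rewrite [in RHS](lagrange_interpolation xi_inj sp) raddf_sum
  horner_sum.
by apply: eq_bigr => m _; rewrite mxE /= derivZ hornerZ mulrC.
Qed.

Lemma derivative_matrix_row_sum (R : realType) (N : nat) (xi : 'I_N.+1 -> R)
    (xi_inj : injective xi) (i : 'I_N.+1) :
  \sum_m derivative_matrix xi i m = 0.
Proof.
have := @nodal_derivative_exact R N xi xi_inj 1 i;
  rewrite size_poly1 => /(_ isT).
rewrite derivC horner0; apply: etrans.
by apply: eq_bigr => m _; rewrite hornerC mulr1.
Qed.

Lemma GL_nodes_inj (R : realType) (N : nat) (xi : 'I_N.+1 -> R) :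
  GL_nodes xi -> injective xi.
Proof.
rewrite /GL_nodes => -[xi_lt _] i j xij.
by case: (ltngtP i j) => [/xi_lt|/xi_lt|/val_inj//]; rewrite xij ltxx.
Qed.

Section Translation.
Variables (R : realType) (N : nat) (xi : 'I_N.+1 -> R).
Hypothesis xi_inj : injective xi.
Implicit Types (a b c : 'I_N.+1 -> R) (i : 'I_N.+1).
Let D := derivative_matrix xi.
Let Dx := nodal_derivative xi.
Let D0 i : \sum_m D i m = 0 := derivative_matrix_row_sum xi_inj i.

Lemma flux_diff_mean a i : 2 * \sum_m D i m * mean (a i) (a m) = Dx a i.
Proof.
transitivity (a i * \sum_m D i m + Dx a i); last by rewrite D0 mulr0 add0r.
rewrite /Dx /nodal_derivative !mulr_sumr -big_split/=; apply: eq_bigr => m _.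
by rewrite /mean -/D; field.
Qed.

(** The product of means is (a_i b_i + a_i b_m + b_i a_m + a_m b_m) / 4: the
    four terms give, in this order, a multiple of the row sum, the two advective
    parts and the conservative part of the splitting. *)
Lemma flux_diff_mean2 a b i :
  2 * \sum_m D i m * (mean (a i) (a m) * mean (b i) (b m)) = S2 Dx a b i.
Proof.
transitivity (2^-1 * (a i * b i) * (\sum_m D i m) + S2 Dx a b i).
  rewrite /S2 /Dx /nodal_derivative !mulr_sumr -!big_split/= mulr_sumr
    -big_split/=.
  by apply: eq_bigr => m _; rewrite /mean -/D; field.
by rewrite D0 mulr0 add0r.
Qed.

Lemma flux_diff_mean3 a b c i :
  2 * \sum_m D i m * (mean (a i) (a m) * mean (b i) (b m) * mean (c i) (c m))
  = S3 Dx a b c i.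
Proof.
transitivity (4^-1 * (a i * b i * c i) * (\sum_m D i m) + S3 Dx a b c i).
  rewrite /S3 /Dx /nodal_derivative !mulr_sumr -!big_split/= mulr_sumr
    -big_split/=.
  by apply: eq_bigr => m _; rewrite /mean -/D; field.
by rewrite D0 mulr0 add0r.
Qed.

End Translation.

(** * Two-point fluxes and split forms *)

Lemma flux_differencing_euler_form (R : realType) (gamma : R) (N : nat)
    (xi : 'I_N.+1 -> R) (xi_inj : injective xi) (X : formulation) (d : 'I_3)
    (L : 'I_N.+1 -> state R) (i : 'I_N.+1) (c : component) :
  flux_differencing_volume_term xi (volume_flux gamma X) d L i c =
  euler_form gamma (nodal_derivative xi) X d L c i.
Proof.
rewrite /flux_differencing_volume_term.
have splitD (F G : 'I_N.+1 -> R) :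
    2 * \sum_m derivative_matrix xi i m * (F m + G m) =
    2 * (\sum_m derivative_matrix xi i m * F m)
    + 2 * (\sum_m derivative_matrix xi i m * G m).
  by rewrite -mulrDr -big_split/=; under eq_bigr do rewrite mulrDr.
have splitZ (r : R) (F : 'I_N.+1 -> R) :
    2 * \sum_m derivative_matrix xi i m * (r * F m) =
    r * (2 * \sum_m derivative_matrix xi i m * F m).
  by rewrite mulrCA; congr (2 * _); rewrite mulr_sumr; apply: eq_bigr => m _;
    rewrite mulrCA.
have split_sum (F : 'I_3 -> 'I_N.+1 -> R) :
    2 * \sum_m derivative_matrix xi i m * (\sum_q F q m) =
    \sum_q 2 * \sum_m derivative_matrix xi i m * F q m.
  rewrite -mulr_sumr exchange_big/=; congr (2 * _).
  by apply: eq_bigr => m _; rewrite mulr_sumr.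
pose D := derivative_matrix xi; pose Dx := nodal_derivative xi.
have m1 (a : state R -> R) :
    2 * \sum_m D i m * mean (a (L i)) (a (L m)) = Dx (a \o L) i.
  exact: (flux_diff_mean xi_inj (a \o L) i).
have m2 (a b : state R -> R) :
    2 * \sum_m D i m * (mean (a (L i)) (a (L m)) * mean (b (L i)) (b (L m)))
    = S2 Dx (a \o L) (b \o L) i.
  exact: (flux_diff_mean2 xi_inj (a \o L) (b \o L) i).
have m3 (a b e : state R -> R) :
    2 * \sum_m D i m * (mean (a (L i)) (a (L m)) * mean (b (L i)) (b (L m))
                        * mean (e (L i)) (e (L m)))
    = S3 Dx (a \o L) (b \o L) (e \o L) i.
  exact: (flux_diff_mean3 xi_inj (a \o L) (b \o L) (e \o L) i).
have pp (q : 'I_3) : 2 * \sum_m derivative_matrix xi i m * ((q == d)%:R *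
    mean (pressure gamma (L i)) (pressure gamma (L m))) =
  (q == d)%:R * nodal_derivative xi (pressure gamma \o L) i.
  by rewrite splitZ (m1 (pressure gamma)).
case: X; case: c => [|q|] /=.
- exact: (m1 (density \* velocity d)).
- by rewrite splitD pp; congr (_ + _);
  exact: (m1 (density \* velocity d \* velocity q)).
- rewrite (m1 (velocity d \* (density \* @total_energy R \+ pressure gamma))).
  by congr nodal_derivative; apply/funext => m; rewrite /= mulrC.
- exact: (m1 (density \* velocity d)).
- by rewrite splitD pp; congr (_ + _);
  exact: (m2 (density \* velocity d) (velocity q)).
(* Morinishi energy: for each q, the quadratic splitting of
   (rho v_d v_q) and v_q minus half the derivative of their product. *)
- under eq_bigr do rewrite -mulNr -addrA.
  rewrite !splitD (splitZ (- 2^-1)) !split_sum.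
  rewrite (m1 ((density \* @inner_energy R \+ pressure gamma) \* velocity d)).
  congr (_ + _); rewrite !mulr_sumr -big_split/=; apply: eq_bigr => q _.
  rewrite (m2 (density \* velocity d \* velocity q) (velocity q)).
  rewrite (m1 (density \* velocity d \* (velocity q \* velocity q))) /S2.
  have -> : (density \* velocity d \* (velocity q \* velocity q)) \o L =
      ((density \* velocity d \* velocity q) \o L) \* (velocity q \o L).
    by apply/funext => m; rewrite /= mulrA.
  rewrite -[nodal_derivative xi (_ \* _) i]/(Dx ((density \* velocity d \*
    velocity q) \o L) i) -/Dx.
  by rewrite /=; ring.
- exact: (m2 density (velocity d)).
- by rewrite splitD pp; congr (_ + _);
  exact: (m2 (density \* velocity q) (velocity d)).
- rewrite -(m2 (density \* @total_energy R \+ pressure gamma) (velocity d)).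
  congr (2 * _); apply: eq_bigr => m _; congr (_ * (_ * _)).
  by rewrite /mean/=; ring.
- exact: (m2 density (velocity d)).
- by rewrite splitD pp; congr (_ + _);
  exact: (m3 density (velocity d) (velocity q)).
- rewrite splitD addrC (m2 (pressure gamma) (velocity d)); congr (_ + _).
  rewrite -(m3 density (@total_energy R) (velocity d)); congr (2 * _).
  by apply: eq_bigr => m _; rewrite /= mulrAC.
- exact: (m2 density (velocity d)).
- by rewrite splitD pp; congr (_ + _);
  exact: (m3 density (velocity d) (velocity q)).
- exact: (m3 density (velocity d) (enthalpy gamma)).
Qed.

Lemma volume_flux_consistent (R : realType) (gamma : R) (X : formulation) :
  consistent_on gamma [set V | 0 < density V] (volume_flux gamma X).
Proof.
have mean_id (a : R) : mean a a = a by rewrite /mean; field.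
move=> d V c /= V0; rewrite /euler_flux.
case: X; case: c => [|q|] /=; rewrite !mean_id//.
- by rewrite mulrC.
- under eq_bigr do rewrite !mean_id;
  under [X in _ - _ * X]eq_bigr do rewrite !mean_id.
  rewrite /inner_energy -addrA -mulNr.
  have -> : \sum_q density V * velocity d V * velocity q V * velocity q V =
      density V * velocity d V * \sum_q velocity q V ^+ 2.
    by rewrite mulr_sumr; apply: eq_bigr => q _; ring.
  have -> : \sum_q density V * velocity d V * (velocity q V * velocity q V) =
      density V * velocity d V * \sum_q velocity q V ^+ 2.
    by rewrite mulr_sumr; apply: eq_bigr => q _; ring.
  by field.
- ring.
- ring.
- rewrite /enthalpy; field.
  by rewrite gt_eqF.
Qed.

(** * Location of the Gauss-Lobatto nodes *)

Lemma derivn_comp_affine (R : comNzRingType) (p : {poly R}) (s : R) (k : nat) :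
  derivn k (p \Po (s *: (1 + 'X))) = s ^+ k *: (derivn k p \Po (s *: (1 + 'X))).
Proof.
elim: k => [|k ih]; first by rewrite !derivn0 expr0 scale1r.
rewrite !derivnS ih derivZ deriv_comp derivZ derivD derivC add0r derivX.
by rewrite -scalerAr mulr1 scalerA exprSr.
Qed.

Lemma horner_gt0 (R : realFieldType) (p : {poly R}) (t : R) :
  p \is a polyOver Num.nneg -> p != 0 -> 0 < t -> 0 < p.[t].
Proof.
move=> /polyOverP p0 pn0 t0; rewrite horner_coef.
have sp : (0 < size p)%N by rewrite size_poly_gt0.
have pi0 i : 0 <= p`_i by rewrite -nnegrE.
rewrite -(prednK sp) big_ord_recr/= ltr_wpDl//.
  by apply: sumr_ge0 => i _; rewrite mulr_ge0 ?pi0// exprn_ge0// ltW.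
by rewrite mulr_gt0 ?exprn_gt0// -lead_coefE lt_def lead_coef_eq0 pn0
  lead_coefE pi0.
Qed.

(** Composed with s (1 + X), where s is the sign of x, the polynomial
    (X^2 - 1)^N becomes (X (X + 2))^N, whose coefficients are nonnegative; its
    derivative of order N + 1 is nonzero since N + 1 <= 2 N, hence positive at
    t = |x| - 1. *)
Lemma derivn_rodrigues_neq0 (R : realFieldType) (N : nat) (x : R) :
  (0 < N)%N -> 1 < `|x| -> (derivn N.+1 (('X^2 - 1) ^+ N)).[x] != 0.
Proof.
move=> N0 x1; pose s : R := Num.sg x.
have x0 : x != 0 by rewrite -normr_gt0 (lt_trans _ x1).
have ss : s ^+ 2 = 1 by rewrite /s sqr_sg x0.
pose l : {poly R} := s *: (1 + 'X).
have ql : (('X^2 - 1) ^+ N) \Po l = ('X * ('X + 2%:P)) ^+ N.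
  rewrite rmorphXn/= rmorphB rmorph1/= rmorphXn/= comp_polyX /l exprZn ss
    scale1r.
  by congr (_ ^+ _); rewrite polyCMn; ring.
have xl : l.[`|x| - 1] = x.
  by rewrite /l hornerZ hornerD hornerC hornerX addrC subrK -numEsg.
have q_monic : ('X * ('X + 2%:P)) ^+ N \is (@monic R).
  by rewrite monic_exp// monicMl ?monicX ?monicXaddC.
have q_size : size (('X * ('X + 2%:P)) ^+ N : {poly R}) = (N * 2).+1.
  rewrite polySpred ?monic_neq0// size_exp size_monicM ?monicX -?size_poly_eq0
    ?size_XaddC//.
  by rewrite size_polyX mulnC.
have : 0 < (derivn N.+1 (('X * ('X + 2%:P)) ^+ N)).[`|x| - 1].
  apply: horner_gt0; last by rewrite subr_gt0.
    apply: polyOver_derivn.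
    by rewrite rpredX// rpredM ?rpredD ?polyOverX// polyOverC nnegrE.
  (* The leading coefficient, in degree 2 N - (N + 1), does not vanish. *)
  apply/eqP => /(congr1 (fun p : {poly R} => p`_(N.-1))).
  rewrite coef0 coef_derivn addSnnS prednK// addnn -muln2.
  have -> : (('X * ('X + 2%:P)) ^+ N : {poly R})`_(N * 2) = 1.
    by move/monicP: q_monic; rewrite lead_coefE q_size.
  by apply/eqP; rewrite pnatr_eq0 -lt0n ffact_gt0 muln2 -addnn -addn1 leq_add2l.
rewrite -ql derivn_comp_affine hornerZ horner_comp xl => h.
by apply: contraTneq h => ->; rewrite mulr0 ltxx.
Qed.

Lemma GL_nodes_bounded (R : realType) (N : nat) (xi : 'I_N.+1 -> R)
    (i : 'I_N.+1) : (0 < N)%N -> GL_nodes xi -> `|xi i| <= 1.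
Proof.
rewrite /GL_nodes => N0 -[_ /(_ i)]; rewrite rootE hornerM mulf_eq0 => /orP[|].
  rewrite !hornerE subr_eq0 sqrf_eq1 => /orP[/eqP->|/eqP->];
    by rewrite ?normrN normr1.
rewrite /legendre derivZ hornerZ mulf_eq0 invr_eq0 mulf_eq0 expf_eq0 pnatr_eq0.
rewrite andbF pnatr_eq0 -[(_ `! == 0)%N]negbK -lt0n fact_gt0/=.
by apply: contraLR; rewrite -ltNge => /(derivn_rodrigues_neq0 N0);
  rewrite derivnS.
Qed.

(** * Calculus of functions with continuous partial derivatives *)

Section CkTheory.
Variables (R : realType) (Omega : set 'rV[R]_3).
Hypothesis Omega_open : open Omega.
Implicit Types (f g : 'rV[R]_3 -> R) (k : nat) (d : 'I_3).

Lemma Ck_continuous k f x : Ck k Omega f -> Omega x -> {for x, continuous f}.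
Proof. by case: k => [|k] [] + _ => /[apply]. Qed.

Lemma Ck_pred k f : Ck k.+1 Omega f -> Ck k Omega f.
Proof.
elim: k f => [|k ih] f [fc fd]; split => // d; have [fdd fdC] := fd d.
by split => //; apply: ih.
Qed.

(** Continuity and partial derivatives at a point of an open set depend only on
    the values in that set. The rules of calculus below give the partial
    derivatives of a sum, product or inverse on [Omega] only, so each induction
    step needs this. *)
Lemma Ck_eq k f g : {in Omega, f =1 g} -> Ck k Omega f -> Ck k Omega g.
Proof.
have near_eq f' g' x : {in Omega, f' =1 g'} -> Omega x -> \near x, f' x = g' x.
  move=> fg Ox; apply: filterS (open_nbhs_nbhs (conj Omega_open Ox)) => y Oy.
  by apply: fg; rewrite inE.
have cont f' g' : {in Omega, f' =1 g'} ->
    (forall x, Omega x -> {for x, continuous f'}) ->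
    forall x, Omega x -> {for x, continuous g'}.
  move=> fg fc x Ox; rewrite /prop_for /continuous_at -(fg x) ?inE//.
  apply: cvg_trans (fc x Ox).
  exact: (@near_eq_cvg _ _ (nbhs x) _ f' g' (near_eq f' g' x fg Ox)).
elim: k f g => [|k ih] f g fg [fc fd]; split=> //; try exact: cont fc.
move=> d; have [fdd fdC] := fd d; split=> [x Ox|].
  exact: near_eq_derivable (near_eq _ _ _ fg Ox) (fdd x Ox).
apply: ih fdC => x /[1!inE] Ox.
exact: near_eq_derive (near_eq _ _ _ fg Ox).
Qed.

Lemma Ck_cst k (r : R) : Ck k Omega (cst r).
Proof.
elim: k r => [|k ih] r; split=> //.
- by move=> x _; exact: cst_continuous.
- by move=> x _; exact: cst_continuous.
move=> d.
split=> [x _|]; first exact: derivable_cst.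
by apply: Ck_eq (ih 0) => x _; rewrite /partial derive_cst.
Qed.

Lemma CkD k f g : Ck k Omega f -> Ck k Omega g -> Ck k Omega (f \+ g).
Proof.
elim: k f g => [|k ih] f g [fc fd] [gc gd]; split=> //.
- by move=> x Ox; apply: continuousD; [apply: fc|apply: gc].
- by move=> x Ox; apply: continuousD; [apply: fc|apply: gc].
move=> d; have [fdd fdC] := fd d; have [gdd gdC] := gd d.
split=> [x Ox|]; first by apply: derivableD; [apply: fdd|apply: gdd].
apply: Ck_eq (ih _ _ fdC gdC) => x /[1!inE] Ox.
by rewrite /partial deriveD//; [apply: fdd|apply: gdd].
Qed.

Lemma Ck_sum k (I : Type) (r : seq I) (F : I -> 'rV[R]_3 -> R) :
  (forall i, Ck k Omega (F i)) -> Ck k Omega (fun x => \sum_(i <- r) F i x).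
Proof.
move=> FC; elim: r => [|i r ih].
  by apply: Ck_eq (Ck_cst k 0) => x _; rewrite big_nil.
by apply: Ck_eq (CkD (FC i) ih) => x _; rewrite big_cons.
Qed.

Lemma CkM k f g : Ck k Omega f -> Ck k Omega g -> Ck k Omega (f \* g).
Proof.
elim: k f g => [|k ih] f g fC gC; have [fc fd] := fC; have [gc gd] := gC;
  split=> //.
- by move=> x Ox; apply: continuousM; [apply: fc|apply: gc].
- by move=> x Ox; apply: continuousM; [apply: fc|apply: gc].
move=> d; have [fdd fdC] := fd d; have [gdd gdC] := gd d.
split=> [x Ox|]; first by apply: derivableM; [apply: fdd|apply: gdd].
apply: Ck_eq (CkD (ih _ _ (Ck_pred fC) gdC) (ih _ _ (Ck_pred gC) fdC)) => x
  /[1!inE] Ox.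
by rewrite /partial deriveM//; [apply: fdd|apply: gdd].
Qed.

Lemma CkV k f : (forall x, Omega x -> f x != 0) ->
  Ck k Omega f -> Ck k Omega (fun x => (f x)^-1).
Proof.
move=> f0; elim: k f f0 => [|k ih] f f0 fC; have [fc fd] := fC; split=> //.
- by move=> x Ox; apply: continuousV; [apply: f0|apply: fc].
- by move=> x Ox; apply: continuousV; [apply: f0|apply: fc].
move=> d; have [fdd fdC] := fd d.
split=> [x Ox|]; first by apply: derivableV; [apply: f0|apply: fdd].
have Vf := ih _ f0 (Ck_pred fC).
apply: Ck_eq (CkM (CkM (Ck_cst k (-1)) (CkM Vf Vf)) fdC) => x /[1!inE] Ox.
rewrite /partial deriveV//; [|exact: f0|exact: fdd].
by rewrite /= mulN1r -invfM -expr2.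
Qed.

Lemma Ck_iter_partial j k d f : Ck (k + j) Omega f ->
  Ck k Omega (iter j (partial d) f).
Proof.
elim: j k => [|j ih] k; first by rewrite addn0.
by rewrite addnS -addSn => /ih[_ /(_ d)[]].
Qed.

End CkTheory.

Lemma continuous_bounded_compact (R : realType) (T : topologicalType)
    (K : set T) (f : T -> R) :
  compact K -> (forall x, K x -> {for x, continuous f}) ->
  exists2 M, 0 <= M & forall x, K x -> `|f x| <= M.
Proof.
move=> cK fc; have /compact_bounded : compact (f @` K).
  by apply: continuous_compact => //;
    apply: continuous_in_subspaceT => x /[1!inE]/fc.
move=> [M [Mreal Mb]]; exists (`|M| + 1); first by rewrite addr_ge0.
move=> x Kx; apply: (Mb (`|M| + 1)); last by exists x.
by rewrite (le_lt_trans (ler_norm M))// ltrDl.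
Qed.

(** * Taylor remainder *)

Lemma increment_le_derivative_bound (R : realType) (h dh : R -> R) (M t : R) :
  (forall s : R, 0 <= s <= 1 -> is_derive s 1 h (dh s)) ->
  (forall s : R, 0 <= s <= 1 -> `|dh s| <= M) ->
  0 <= t <= 1 -> `|h t - h 0| <= M.
Proof.
move=> hd dhM /andP[t0 t1].
have in01 s : s \in `[0, t] -> 0 <= s <= 1.
  by rewrite in_itv/= => /andP[-> /le_trans->].
have [||c /in01 c01 ->] := @MVT_segment R h dh 0 t t0.
- by move=> s /subset_itv_oo_cc/in01/hd.
- by apply: derivable_within_continuous => s /in01/hd[].
rewrite subr0 normrM (ger0_norm t0) (le_trans _ (dhM c c01))//.
by rewrite ler_piMr.
Qed.

(** On the unit interval the powers of t can be dropped from the remainder, so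
    the derivative of the remainder of H 0 is the remainder of H 1 and the same
    bound M passes from one order to the next by the mean value inequality.
    Taking the successive derivatives as a sequence H avoids iterated
    derivatives in one variable, and reaches segments of either orientation by
    the parametrization t * s of [is_derive_along_line]. *)
Lemma taylor_remainder_bound (R : realType) (H : nat -> R -> R) (M : R)
    (n : nat) :
  (forall k (t : R), (k <= n)%N -> 0 <= t <= 1 ->
    is_derive t 1 (H k) (H k.+1 t)) ->
  (forall t : R, 0 <= t <= 1 -> `|H n.+1 t| <= M) ->
  forall t : R, 0 <= t <= 1 ->
  `|H 0%N t - \sum_(k < n.+1) H k 0 / k`!%:R * t ^+ k| <= M.
Proof.
pose T m (G : nat -> R -> R) : {poly R} := \poly_(k < m) (G k 0 / k`!%:R).
have TE m (G : nat -> R -> R) (s : R) :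
    \sum_(k < m) G k 0 / k`!%:R * s ^+ k = (T m G).[s].
  by rewrite /T horner_poly.
have T0 m G : (T m.+1 G).[0] = G 0%N 0.
  rewrite -TE big_ord_recl big1 => [|i _]; last by rewrite expr0n mulr0.
  by rewrite fact0 divr1 expr0 mulr1 addr0.
have dT m G : deriv (T m.+1 G) = T m (fun k => G k.+1).
  apply/polyP => i; rewrite coef_deriv !coef_poly ltnS; case: ifP => _;
    last by rewrite mul0rn.
  by rewrite factS natrM -mulr_natr; field;
    rewrite nat1r !pnatr_eq0 -lt0n fact_gt0.
have antiderivative m (G : nat -> R -> R) :
    (forall s : R, 0 <= s <= 1 -> is_derive s 1 (G 0%N) (G 1%N s)) ->
    (forall s : R, 0 <= s <= 1 ->
       `|G 1%N s - (T m (fun k => G k.+1)).[s]| <= M) ->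
    forall t : R, 0 <= t <= 1 -> `|G 0%N t - (T m.+1 G).[t]| <= M.
  move=> Gd GM t t01; rewrite -[_ - _]subr0 -(subrr (G 0%N 0)) -{2}(T0 m).
  apply: (@increment_le_derivative_bound _ (G 0%N - horner (T m.+1 G))
    (fun s => G 1%N s - (deriv (T m.+1 G)).[s])) => // s s01.
    by apply: is_deriveB; apply: Gd.
  by rewrite dT; apply: GM.
elim: n H => [|n ih] H Hd HM t t01; rewrite TE;
  apply: antiderivative => // s s01.
- exact: Hd.
- by rewrite -TE big_ord0 subr0 HM.
- exact: Hd.
by rewrite -TE; apply: (ih (fun k => H k.+1)) => // k r kn; apply: Hd.
Qed.

(** * Error of the collocation derivative on an element *)

Lemma is_derive_along_line (R : realType) (f : 'rV[R]_3 -> R) (d : 'I_3)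
    (p : 'rV[R]_3) (s t : R) :
  derivable f ((t * s) *: delta_mx 0 d + p) (delta_mx 0 d) ->
  is_derive t 1 (fun r => f ((r * s) *: delta_mx 0 d + p))
    (s * partial d f ((t * s) *: delta_mx 0 d + p)).
Proof.
move=> fd; pose G u := f (u *: delta_mx 0 d + p).
have GE (u : R) : (fun h : R => h^-1 *: (G (h *: 1 + u) - G u)) =
    (fun h => h^-1 *: (f (h *: delta_mx 0 d + (u *: delta_mx 0 d + p))
                       - f (u *: delta_mx 0 d + p))).
  by apply/funext => h; rewrite /G addrA -scalerDl [h *: 1]mulr1.
have Gd : is_derive (t * s) 1 G (partial d f ((t * s) *: delta_mx 0 d + p)).
  by apply: DeriveDef; rewrite /derivable /derive GE.
have sd : is_derive t 1 (fun r : R => r * s) s.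
  have := @is_deriveZ _ _ _ id s t 1 1 (is_derive_id t 1).
  rewrite [s *: 1]mulr1; suff -> : s \*: id = (fun r : R => r * s) by [].
  by apply/funext => r; rewrite /= mulrC.
rewrite [s * partial _ _ _]mulrC.
by have := @is_derive1_comp R G (fun r => r * s) t _ _ Gd sd; apply.
Qed.

Section Elements.
Variables (R : realType) (N : nat) (xi : 'I_N.+1 -> R).
Hypothesis xi_bound : forall i, `|xi i| <= 1.
Implicit Types (Delta p : 'rV[R]_3) (J : node_index (N := N)) (d : 'I_3).

Lemma node_set_index x0 Delta J d m :
  node xi x0 Delta (set_index J d m) =
  (Delta 0 d / 2 * (xi m - xi (J d))) *: delta_mx 0 d + node xi x0 Delta J.
Proof.
apply/rowP => q; rewrite !mxE /set_index eqxx/= [q == d]eq_sym.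
by case: eqVneq => [<-|_]/=; ring.
Qed.

Lemma node_in_element x0 Delta J :
  (forall d, 0 < Delta 0 d) -> element x0 Delta (node xi x0 Delta J).
Proof.
move=> Dpos q; rewrite mxE; have := xi_bound (J q);
  rewrite ler_norml => /andP[l u].
by have Dq := Dpos q; apply/andP; split; nra.
Qed.

Lemma element_convex_line x0 Delta p d (s t : R) :
  element x0 Delta p -> element x0 Delta (s *: delta_mx 0 d + p) ->
  0 <= t <= 1 -> element x0 Delta ((t * s) *: delta_mx 0 d + p).
Proof.
move=> ep es /andP[t0 t1] q; have := ep q; have := es q; rewrite !mxE eqxx/=.
case: (q == d); rewrite ?mulr1 ?mulr0 ?add0r// => /andP[l1 u1] /andP[l2 u2].
by apply/andP; split; nra.
Qed.

End Elements.

Section Accuracy.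
Variables (R : realType) (N : nat) (xi : 'I_N.+1 -> R).
Hypotheses (N_gt0 : (0 < N)%N) (xi_inj : injective xi).
Hypothesis xi_bound : forall i, `|xi i| <= 1.
Variables (Omega K : set 'rV[R]_3).
Hypotheses (Omega_open : open Omega) (K_compact : compact K).
Hypothesis KOmega : K `<=` Omega.
Variable d : 'I_3.
Implicit Types (Delta : 'rV[R]_3) (J : node_index (N := N)).

(** The factor 2 / Delta_d undoes the affine map from the reference interval.
    Write P for the Taylor polynomial at the node, in the reference variable.
    As P is differentiated exactly, the error is 2 / Delta_d times the
    collocation derivative of the remainder, whose nodal values are at most
    M Delta_d^(N+1). *)
Lemma nodal_derivative_error (f : 'rV[R]_3 -> R) : Ck N.+1 Omega f ->
  exists2 C, 0 <= C & forall x0 Delta J,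
    (forall q, 0 < Delta 0 q) -> element x0 Delta `<=` K ->
    `|2 / Delta 0 d * nodal_derivative xi
        (fun m => f (node xi x0 Delta (set_index J d m))) (J d)
      - partial d f (node xi x0 Delta J)| <= C * Delta 0 d ^+ N.
Proof.
move=> fC; pose F k := iter k (partial d) f.
have FC k : (k <= N.+1)%N -> Ck (N.+1 - k) Omega (F k).
  by move=> kN; apply: Ck_iter_partial; rewrite subnK.
have [M M0 FM] : exists2 M, 0 <= M & forall x, K x -> `|F N.+1 x| <= M.
  apply: continuous_bounded_compact => // x /KOmega Ox.
  exact: Ck_continuous (FC _ (leqnn _)) Ox.
pose S := \sum_i \sum_m `|derivative_matrix xi i m|.
exists (2 * (S * M)).
  by rewrite !mulr_ge0// sumr_ge0// => i _; rewrite sumr_ge0.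
move=> x0 Delta J Dpos elK; set D := Delta 0 d; set p := node _ _ _ J.
have D0 : 0 < D by exact: Dpos.
set i := J d; pose s m := D / 2 * (xi m - xi i).
pose P : {poly R} := \sum_(k < N.+1)
  (F k p / k`!%:R * (D / 2) ^+ k) *: ('X - (xi i)%:P) ^+ k.
have sP : (size P <= N.+1)%N.
  apply: leq_trans (size_sum _ _ _) _; apply/bigmax_leqP => k _.
  by rewrite (leq_trans (size_scale_leq _ _))// size_exp_XsubC.
have P' : (deriv P).[xi i] = D / 2 * partial d f p.
  rewrite /P raddf_sum horner_sum (bigD1 (Ordinal (N_gt0 : 1 < N.+1)%N))//=.
  rewrite derivZ hornerZ expr1 derivXsubC hornerC big1 ?addr0 => [|k k1].
    by rewrite factS fact0 muln1 mulr1n invr1 !mulr1 mulrC.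
  rewrite derivZ hornerZ deriv_exp derivXsubC mul1r hornerMn horner_exp
    !hornerE.
  case: k k1 => -[|[|k]] //= kN _; first by rewrite mulr0n mulr0.
  by rewrite subrr expr0n/= mul0rn mulr0.
have Rm m :
    `|f (node xi x0 Delta (set_index J d m)) - P.[xi m]| <= M * D ^+ N.+1.
  rewrite node_set_index -/p -/D -/i -/(s m).
  have eP : element x0 Delta p by exact: node_in_element.
  have es : element x0 Delta (s m *: delta_mx 0 d + p).
    by have := node_in_element xi_bound x0 (set_index J d m) Dpos;
      rewrite node_set_index.
  pose H k (t : R) := s m ^+ k * F k ((t * s m) *: delta_mx 0 d + p).
  have sD : `|s m| <= D.
    rewrite /s normrM gtr0_norm ?divr_gt0// -[leRHS](@divfK _ 2)//.
    rewrite ler_pM2l ?divr_gt0// (le_trans (ler_normB _ _))//.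
    by rewrite (le_trans (lerD (xi_bound _) (xi_bound _))).
  have := @taylor_remainder_bound _ H (M * D ^+ N.+1) N _ _ 1.
  rewrite /H expr0 !mul1r ler01 lexx => -/(_ _ _ isT).
  have -> : \sum_(k < N.+1) s m ^+ k * F k ((0 * s m) *: delta_mx 0 d + p)
      / k`!%:R * 1 ^+ k = P.[xi m].
    rewrite /P horner_sum; apply: eq_bigr => k _.
    rewrite hornerZ horner_exp hornerXsubC mul0r scale0r add0r expr1n exprMn.
    by ring.
  apply.
  - move=> k t kN t01.
    have ek := element_convex_line eP es t01.
    have [_ /(_ d) [Fd _]] : Ck (N.+1 - k.+1).+1 Omega (F k).
      by rewrite subnSK ?ltnS//; exact: FC (leqW kN).
    have := is_derive_along_line (Fd _ (KOmega (elK _ ek))).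
    by move=> /(@is_deriveZ _ _ _ _ (s m ^+ k));
      rewrite /GRing.scale/= mulrA -exprSr.
  move=> t t01; rewrite normrM mulrC normrX ler_pM//.
    by apply: FM; apply: elK; exact: element_convex_line.
  by rewrite lerXn2r ?nnegrE// ltW.
have -> : partial d f p = 2 / D * (deriv P).[xi i].
  by rewrite P'; field; rewrite gt_eqF.
rewrite -(nodal_derivative_exact xi_inj _ sP) -mulrBr normrM gtr0_norm
  ?divr_gt0//.
rewrite /nodal_derivative -sumrB.
have -> : 2 * (S * M) * D ^+ N = 2 / D * (S * (M * D ^+ N.+1)).
  by rewrite exprS; field; rewrite gt_eqF.
rewrite ler_pM2l ?divr_gt0//; apply: le_trans (ler_norm_sum _ _ _) _.
apply: (@le_trans _ _ (\sum_m `|derivative_matrix xi i m| * (M * D ^+ N.+1))).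
  by apply: ler_sum => m _; rewrite -mulrBr normrM ler_wpM2l.
have MD0 : 0 <= M * D ^+ N.+1 by apply: mulr_ge0 => //; exact/exprn_ge0/ltW.
rewrite -mulr_suml ler_wpM2r//.
by rewrite /S [leRHS](bigD1 i)//= lerDl sumr_ge0// => j _; rewrite sumr_ge0.
Qed.

End Accuracy.

(** * Error of first-order forms *)

Section FormAccuracy.
Variables (R : realType) (gamma : R) (N : nat) (xi : 'I_N.+1 -> R).
Hypotheses (N_gt0 : (0 < N)%N) (xi_inj : injective xi).
Hypothesis xi_bound : forall i, `|xi i| <= 1.
Variables (Omega K : set 'rV[R]_3).
Hypotheses (Omega_open : open Omega) (K_compact : compact K).
Hypothesis KOmega : K `<=` Omega.
Variable U : 'rV[R]_3 -> state R.
Hypothesis U_smooth : forall c, Ck N.+1 Omega (fun x => U x c).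
Hypothesis U_density : forall x, Omega x -> 0 < density (U x).
Variable d : 'I_3.

Let regular (a : state R -> R) := Ck N.+1 Omega (a \o U).

(** Expressions in a differential operator, polymorphic in the set of points, so
    that the same expression is evaluated on the nodes of a line and on the
    space. *)
Let form := forall T : Type,
  ((T -> R) -> T -> R) -> (T -> state R) -> T -> R.

(** A form is linear in its operator, so the metric factor 2 / [Delta 0 d] of
    the collocation derivative may multiply the whole form. The property passes
    to sums of forms and to their multiples by coefficients, which reduces it to
    the derivative of a single quantity. *)
Definition accurate (E : form) : Prop :=
  exists2 C, 0 <= C & forall (x0 Delta : 'rV[R]_3) (J : node_index (N := N)),
    (forall q, 0 < Delta 0 q) -> element x0 Delta `<=` K ->
    `|2 / Delta 0 d * E _ (nodal_derivative xi)
        (fun m => U (node xi x0 Delta (set_index J d m))) (J d)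
      - E _ (partial d) U (node xi x0 Delta J)| <= C * Delta 0 d ^+ N.

Lemma accurate_Dx a : regular a -> accurate (fun T Dx V => Dx (a \o V)).
Proof. exact: nodal_derivative_error. Qed.

Lemma accurateD E1 E2 : accurate E1 -> accurate E2 ->
  accurate (fun T Dx V x => E1 T Dx V x + E2 T Dx V x).
Proof.
move=> [C1 C10 H1] [C2 C20 H2]; exists (C1 + C2); first exact: addr_ge0.
move=> x0 Delta J Dpos elK; rewrite [2 / _ * _]mulrDr opprD addrACA.
rewrite [(C1 + C2) * _]mulrDl.
exact: le_trans (ler_normD _ _) (lerD (H1 _ _ _ Dpos elK) (H2 _ _ _ Dpos elK)).
Qed.

Lemma set_index_id (J : node_index (N := N)) : set_index J d (J d) = J.
Proof. by apply/funext => q; rewrite /set_index; case: eqP => [->|]. Qed.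

(** A coefficient is evaluated at the same node in both expressions, and is
    bounded on the compact set [K]. *)
Lemma accurateM a E1 : regular a -> accurate E1 ->
  accurate (fun T Dx V x => a (V x) * E1 T Dx V x).
Proof.
move=> ra [C C0 H].
have [M M0 aM] : exists2 M, 0 <= M & forall x, K x -> `|a (U x)| <= M.
  by apply: continuous_bounded_compact => // x /KOmega Ox;
    exact: (Ck_continuous ra).
exists (M * C); first exact: mulr_ge0.
move=> x0 Delta J Dpos elK; rewrite set_index_id mulrCA -mulrBr normrM -mulrA.
by rewrite ler_pM// ?H// aM//; apply: elK; exact: node_in_element.
Qed.

Lemma accurate_sum (E : 'I_3 -> form) : (forall q, accurate (E q)) ->
  accurate (fun T Dx V x => \sum_q E q T Dx V x).
Proof.
move=> Eacc; have [C CP] := choice (fun q => let: ex_intro2 C C0 H := Eacc q in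
  ex_intro (fun C => 0 <= C /\ _) C (conj C0 H)).
exists (\sum_q C q); first by apply: sumr_ge0 => q _; case: (CP q).
move=> x0 Delta J Dpos elK; rewrite mulr_sumr -sumrB mulr_suml.
apply: le_trans (ler_norm_sum _ _ _) _; apply: ler_sum => q _.
by have [_] := CP q; apply.
Qed.

Let regular_cst (r : R) : regular (cst r).
Proof. exact: Ck_cst. Qed.

Lemma accurate_S2 a b : regular a -> regular b ->
  accurate (fun T Dx V => S2 Dx (a \o V) (b \o V)).
Proof.
move=> ra rb; apply: (accurateM (regular_cst 2^-1)).
have rab : regular (a \* b) by exact: CkM.
apply: (accurateD (accurateD (accurate_Dx rab)
  (accurateM ra (accurate_Dx rb)))).
exact: (accurateM rb (accurate_Dx ra)).
Qed.

Lemma accurate_S3 a b c : regular a -> regular b -> regular c ->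
  accurate (fun T Dx V => S3 Dx (a \o V) (b \o V) (c \o V)).
Proof.
move=> ra rb rc; apply: (accurateM (regular_cst 4^-1)).
have rM (f g : state R -> R) : regular f -> regular g -> regular (f \* g).
  exact: CkM.
have Dx2 f g : regular f -> regular g ->
    accurate (fun T Dx V => Dx ((f \* g) \o V)).
  by move=> rf rg; apply: accurate_Dx; exact: rM.
have abc := accurate_Dx (rM _ _ (rM _ _ ra rb) rc).
apply: (accurateD (accurateD (accurateD (accurateD (accurateD (accurateD abc
  (accurateM ra (Dx2 _ _ rb rc))) (accurateM rb (Dx2 _ _ ra rc)))
  (accurateM rc (Dx2 _ _ ra rb)))
  (accurateM (rM _ _ rb rc) (accurate_Dx ra)))
  (accurateM (rM _ _ ra rc) (accurate_Dx rb)))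
  (accurateM (rM _ _ ra rb) (accurate_Dx rc))).
Qed.

Let regularM a b : regular a -> regular b -> regular (a \* b).
Proof. exact: CkM. Qed.

Let regularD a b : regular a -> regular b -> regular (a \+ b).
Proof. exact: CkD. Qed.

Let regular_density : regular density.
Proof. exact: U_smooth. Qed.

Let regular_div a : regular a -> regular (fun V => a V / density V).
Proof.
move=> ra; apply: (regularM (b := fun V => (density V)^-1)) => //.
by apply: CkV => // x Ox; rewrite gt_eqF// U_density.
Qed.

Let regular_velocity q : regular (velocity q).
Proof. by apply: regular_div; exact: (U_smooth (Momentum q)). Qed.

Let regular_total_energy : regular (@total_energy R).
Proof. by apply: regular_div; exact: (U_smooth Energy). Qed.

Let regular_inner_energy : regular (@inner_energy R).
Proof.
have : regular (fun V => total_energy V + (- 2^-1) *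
    \sum_q velocity q V * velocity q V).
  apply: regularD => //; apply: (regularM (regular_cst _)).
  by apply: Ck_sum => // q; exact: (regularM (regular_velocity q)
    (regular_velocity q)).
by apply: Ck_eq => // x _; rewrite /inner_energy/= mulNr.
Qed.

Let regular_pressure : regular (pressure gamma).
Proof.
exact: (regularM (regularM (regular_cst (gamma - 1)) regular_density)
  regular_inner_energy).
Qed.

Let regular_enthalpy : regular (enthalpy gamma).
Proof.
exact: (regularD regular_total_energy (regular_div regular_pressure)).
Qed.

Lemma euler_form_accurate (X : formulation) (c : component) :
  accurate (fun T Dx V => euler_form gamma Dx X d V c).
Proof.
have r := regular_density; have v := regular_velocity.
have e := regular_total_energy; have th := regular_inner_energy.
have p := regular_pressure; have h := regular_enthalpy.
have rv := regularM r (v d).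
have pp q : accurate (fun T Dx V x => (q == d)%:R * Dx (pressure gamma \o V) x).
  by apply: (accurateM (regular_cst _)); exact: accurate_Dx.
case: X; case: c => [|q|].
- exact: (accurate_Dx rv).
- exact: (accurateD (accurate_Dx (regularM rv (v q))) (pp q)).
- exact: (accurate_Dx (regularM (regularD (regularM r e) p) (v d))).
- exact: (accurate_Dx rv).
- exact: (accurateD (accurate_S2 rv (v q)) (pp q)).
- apply: (accurateD (accurate_Dx (regularM (regularD (regularM r th) p)
    (v d)))).
  apply: (accurateM (regular_cst 2^-1)); apply: accurate_sum => q.
  have rvv := regularM rv (v q).
  exact: (accurateD (accurateM rvv (accurate_Dx (v q)))
    (accurateM (v q) (accurate_Dx rvv))).
- exact: (accurate_S2 r (v d)).
- exact: (accurateD (accurate_S2 (regularM r (v q)) (v d)) (pp q)).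
- exact: (accurate_S2 (regularD (regularM r e) p) (v d)).
- exact: (accurate_S2 r (v d)).
- exact: (accurateD (accurate_S3 r (v d) (v q)) (pp q)).
- exact: (accurateD (accurate_S2 p (v d)) (accurate_S3 r e (v d))).
- exact: (accurate_S2 r (v d)).
- exact: (accurateD (accurate_S3 r (v d) (v q)) (pp q)).
- exact: (accurate_S3 r (v d) h).
Qed.

End FormAccuracy.

(** * The discretisation of the Euler equations *)

(** Both arguments of the surface flux are the same state when the field is
    continuous across the faces. *)
Lemma interface_term_eq0 (R : realType) (gamma : R) (N : nat)
    (xi : 'I_N.+1 -> R) (A : set (state R)) (Fs : numerical_flux (R := R))
    (d : 'I_3) (W : node_index (N := N) -> state R) (J : node_index) c :
  consistent_on gamma A Fs -> A (W J) ->
  interface_term gamma xi Fs d (fun=> W) W J c = 0.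
Proof.
by move=> Fs_cons AW; rewrite /interface_term Fs_cons// subrr !mulr0 subrr.
Qed.

(** Turns one constant for each component into a common one. *)
Lemma component_le_sum (R : realDomainType) (g : component -> R) c :
  (forall c', 0 <= g c') -> g c <= g Mass + \sum_q g (Momentum q) + g Energy.
Proof.
move=> g0; have s0 : 0 <= \sum_q g (Momentum q) by apply: sumr_ge0.
have := g0 Mass; have := g0 Energy.
case: c => [|q|]; [lra| |lra].
have : g (Momentum q) <= \sum_q g (Momentum q).
  by rewrite (bigD1 q)//= lerDl sumr_ge0.
lra.
Qed.
Theorem theorem1 (R : realType) (gamma : R) (N : nat) (xi : 'I_N.+1 -> R)
  (N_gt0 : (0 < N)%N) (xi_GL : GL_nodes xi) :
  let D := derivative_matrix xi in
  let Dx := nodal_derivative xi in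
  (* translation of derivatives of single quantities, products and triple
     products into two-point fluxes *)
  [/\ forall (a : 'I_N.+1 -> R) i,
        2 * \sum_m D i m * mean (a i) (a m) = Dx a i,
      forall (a b : 'I_N.+1 -> R) i,
        2 * \sum_m D i m * (mean (a i) (a m) * mean (b i) (b m))
        = S2 Dx a b i
    & forall (a b c : 'I_N.+1 -> R) i,
        2 * \sum_m D i m
              * (mean (a i) (a m) * mean (b i) (b m) * mean (c i) (c m))
        = S3 Dx a b c i] /\
  (* the volume fluxes generate the discrete split forms, and the standard
     DGSEM for the divergence form *)
  (forall (X : formulation) (d : 'I_3) (L : 'I_N.+1 -> state R) i c,
      flux_differencing_volume_term xi (volume_flux gamma X) d L i c
      = euler_form gamma Dx X d L c i) /\
  (forall (d : 'I_3) (L : 'I_N.+1 -> state R) i c,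
      flux_differencing_volume_term xi
        (volume_flux gamma StandardDivergence) d L i c
      = standard_volume_term gamma xi d L i c) /\
  (* consistency *)
  (forall X : formulation,
      consistent_on gamma [set V | 0 < density V] (volume_flux gamma X)) /\
  (* accuracy of order N, for fields smooth on an open set, uniformly over the
     elements contained in a compact subset *)
  (forall (X : formulation) (Omega K : set 'rV[R]_3)
      (U : 'rV[R]_3 -> state R),
      open Omega -> compact K -> K `<=` Omega ->
      (forall c, Ck N.+1 Omega (fun x => U x c)) ->
      (forall x, Omega x -> 0 < density (U x)) ->
      exists C : R, forall (x0 Delta : 'rV[R]_3) (Fs : numerical_flux),
        (forall d, 0 < Delta 0 d) ->
        element x0 Delta `<=` K ->
        consistent_on gamma (U @` Omega) Fs ->
        let vol := flux_differencing_volume_term xi (volume_flux gamma X) in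
        let W J := U (node xi x0 Delta J) in
        let outer (d : 'I_3) (s : bool) J := W J in
        forall J c,
          (forall d,
            `|dgsem_direction gamma xi vol Fs Delta outer W d J c
              - euler_form gamma (partial d) X d U c (node xi x0 Delta J)|
            <= C * Delta 0 d ^+ N) /\
          (forall h, (forall d, Delta 0 d <= h) ->
            `|dgsem_operator gamma xi vol Fs Delta outer W J c
              - \sum_d euler_form gamma (partial d) X d U c
                         (node xi x0 Delta J)|
            <= C * h ^+ N)).
Proof.
move=> D Dx.
have xi_inj := GL_nodes_inj xi_GL.
have xi_bound i : `|xi i| <= 1 by exact: GL_nodes_bounded.
split.
  by split=> *;
    [exact: flux_diff_mean|exact: flux_diff_mean2|exact: flux_diff_mean3].
split; first by move=> X d L i c; exact: flux_differencing_euler_form.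
split.
  move=> d L i c; rewrite flux_differencing_euler_form//.
  case: c => [|q|] //; rewrite /= /nodal_derivative mulr_sumr -big_split/=.
  by apply: eq_bigr => m _; rewrite mulrDr [X in _ + X]mulrCA.
split; first by move=> X; exact: volume_flux_consistent.
move=> X Omega K U Omega_open K_compact KOmega U_smooth U_density.
pose nodal_states x0 Delta (J : node_index) := U (node xi x0 Delta J).
have /choice[C CP] (dc : 'I_3 * component) : exists C : R, 0 <= C /\
    forall (x0 Delta : 'rV[R]_3) (Fs : numerical_flux) J,
    (forall q, 0 < Delta 0 q) -> element x0 Delta `<=` K ->
    consistent_on gamma (U @` Omega) Fs ->
    `|dgsem_direction gamma xi
        (flux_differencing_volume_term xi (volume_flux gamma X)) Fs Delta
        (fun _ _ => nodal_states x0 Delta) (nodal_states x0 Delta) dc.1 J dc.2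
      - euler_form gamma (partial dc.1) X dc.1 U dc.2 (node xi x0 Delta J)|
    <= C * Delta 0 dc.1 ^+ N.
  have [C C0 CP] := euler_form_accurate gamma N_gt0 xi_inj xi_bound Omega_open
    K_compact KOmega U_smooth U_density dc.1 X dc.2.
  exists C; split=> // x0 Delta Fs J Dpos elK Fs_cons.
  have UO : (U @` Omega) (nodal_states x0 Delta J).
    by exists (node xi x0 Delta J) => //; apply/KOmega/elK;
      exact: node_in_element.
  rewrite /dgsem_direction (interface_term_eq0 xi dc.1 dc.2 Fs_cons UO) addr0.
  by rewrite flux_differencing_euler_form//; exact: CP.
have C0 d c : 0 <= C (d, c) by have [] := CP (d, c).
pose Cd d := C (d, Mass) + \sum_q C (d, Momentum q) + C (d, Energy).
have CCd d c : C (d, c) <= Cd d.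
  by apply: (component_le_sum (g := fun c => C (d, c))).
have Cd0 d : 0 <= Cd d by exact: le_trans (C0 d Mass) (CCd d Mass).
exists (\sum_d Cd d) => x0 Delta Fs Dpos elK Fs_cons vol W outer J c.
have err d := (CP (d, c)).2 x0 Delta Fs J Dpos elK Fs_cons.
have Dn d : 0 <= Delta 0 d ^+ N by exact/exprn_ge0/ltW.
split=> [d|h Dh].
  apply: le_trans (err d) _; rewrite ler_wpM2r//.
  by apply: le_trans (CCd d c) _; rewrite (bigD1 d)//= lerDl sumr_ge0.
rewrite /dgsem_operator -sumrB mulr_suml.
apply: le_trans (ler_norm_sum _ _ _) _; apply: ler_sum => d _.
apply: le_trans (err d) _; rewrite ler_pM//.
by rewrite lerXn2r ?nnegrE// ltW// (lt_le_trans (Dpos d)).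
Qed.
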